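(* Let $\{(x_k,y_k,\gamma_k)\}_{k\ge 0}$ and $\{(\tilde x_k,\tilde\gamma_k)\}_{k\ge 1}$ be sequences generated by the partially inexact proximal ADMM (described in the context). Then, for every $k\ge 1$, $$\frac1\beta(x_{k-1}-x_k)\in \partial f(\tilde x_k)-A^*\tilde\gamma_k,\qquad (H+\beta B^*B)(y_{k-1}-y_k)\in\partial g(y_k)-B^*\tilde\gamma_k,\qquad \frac{1}{\beta\theta}(\gamma_{k-1}-\gamma_k)=A\tilde x_k+By_k-b.$$ Moreover, there exists $\sigma\in\,]0,1[$, namely a scalar $\sigma\in[\tau_2,1[$ depending only on $\tau_1,\tau_2,\theta$ such that the matrix $G_\sigma$ (defined in the context) is positive semidefinite, such that for every $k\ge 1$ there exists $i\le k$ (with $i\geq 1$) satisfying $$\left(\frac1\beta\|x_{i-1}-x_i\|^2+\|y_{i-1}-y_i\|^2_{(H+\beta B^*B)}+\frac{1}{\beta\theta}\|\gamma_{i-1}-\gamma_i\|^2\right)^{1/2}\le \frac{\sqrt{d_0}}{\sqrt k}\sqrt{\frac{2(1+\sigma)+4\mu}{1-\sigma}},$$ where $d_0$ and $\mu=\mu(\sigma)$ are as defined in the context.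
   Context: Setting. $\mathcal X,\mathcal Y,\Gamma$ are finite-dimensional real inner product spaces (norm $\|\cdot\|$ induced by the inner product); $f:\mathcal X\to[-\infty,\infty]$ and $g:\mathcal Y\to[-\infty,\infty]$ are proper, closed, convex functions; $A:\mathcal X\to\Gamma$, $B:\mathcal Y\to\Gamma$ are linear operators with adjoints $A^*,B^*$; $b\in\Gamma$. The problem is $\min\{f(x)+g(y): Ax+By=b\}$. For a self-adjoint positive semidefinite linear operator $Q$, $\|v\|_Q=\langle Qv,v\rangle^{1/2}$. $\partial f$ denotes the convex subdifferential. Partially inexact proximal ADMM. Data: an initial point $(x_0,y_0,\gamma_0)\in\mathcal X\times\mathcal Y\times\Gamma$, a penalty parameter $\beta>0$, error tolerances $\tau_1,\tau_2\in[0,1[$, a self-adjoint positive semidefinite linear operator $H:\mathcal Y\to\mathcal Y$, and a stepsize $$\theta\in\left]0,\ \frac{1-2\tau_1+\sqrt{(1-2\tau_1)^2+4(1-\tau_1)}}{2(1-\tau_1)}\right[.$$ For each $k\ge1$: (Step 1) compute $(v_k,\tilde x_k)\in\mathcal X\times\mathcal X$ such that $$v_k\in\partial f(\tilde x_k)-A^*\tilde\gamma_k,\qquad \|\tilde x_k-x_{k-1}+\beta v_k\|^2\le\tau_1\|\tilde\gamma_k-\gamma_{k-1}\|^2+\tau_2\|\tilde x_k-x_{k-1}\|^2,$$ where $\tilde\gamma_k=\gamma_{k-1}-\beta(A\tilde x_k+By_{k-1}-b)$, and compute an optimal solution $y_k\in\mathcal Y$ of $$\min_{y\in\mathcal Y}\Big\{g(y)-\langle\gamma_{k-1},By\rangle+\frac\beta2\|A\tilde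 x_k+By-b\|^2+\frac12\|y-y_{k-1}\|_H^2\Big\};$$ (Step 2) set $x_k=x_{k-1}-\beta v_k$ and $\gamma_k=\gamma_{k-1}-\theta\beta(A\tilde x_k+By_k-b)$. Let $\mathcal Z=\mathcal X\times\mathcal Y\times\Gamma$, let $T:\mathcal Z\rightrightarrows\mathcal Z$ be $T(x,y,\gamma)=(\partial f(x)-A^*\gamma)\times(\partial g(y)-B^*\gamma)\times\{Ax+By-b\}$, and let $M:\mathcal Z\to\mathcal Z$ be $M(x,y,\gamma)=(x/\beta,\ (H+\beta B^*B)y,\ \gamma/(\theta\beta))$. Standing assumption: $T^{-1}(0)=\{z\in\mathcal Z:0\in T(z)\}$ is nonempty. Define $$d_0=\inf\{\|(x-x_0,y-y_0,\gamma-\gamma_0)\|_M^2:(x,y,\gamma)\in T^{-1}(0)\}.$$ For $\sigma\in[0,1[$ define $$G_\sigma=\begin{bmatrix}\sigma-1+(\sigma-\tau_1)\theta & (1-\theta)[\sigma-1+(1-\tau_1)\theta]\\ (1-\theta)[\sigma-1+(1-\tau_1)\theta] & \sigma-1+(2-\theta-\tau_1)\theta\end{bmatrix},$$ $$\mu=\mu(\sigma)=\frac{4[\sigma-1+(1-\tau_1)\theta]}{\theta^{3/2}}\max\Big\{1,\frac{\theta}{2-\theta}\Big\}.$$ *)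

(* Defs.v *)
From HB Require Import structures.
From mathcomp Require Import all_boot all_order all_algebra.
From mathcomp Require Import sesquilinear.
From mathcomp Require Import all_classical all_reals all_analysis.

Set Implicit Arguments.
Unset Strict Implicit.
Unset Printing Implicit Defensive.

Import Order.TTheory GRing.Theory Num.Theory.
Local Open Scope classical_set_scope.
Local Open Scope ring_scope.

(* A finite-dimensional real inner product space is a [vectType R] together
   with a form of type [{dot X for idfun}] (bilinear, symmetric, positive
   definite).  The definitions below only use the underlying function
   [ip : X -> X -> R]. *)

Definition ipnorm (R : realType) (X : vectType R) (ip : X -> X -> R) (x : X) : R :=
  Num.sqrt (ip x x).

(* The (semi)norm <Q x, x>^(1/2) for self-adjoint positive semidefinite Q. *)
Definition opnorm (R : realType) (X : Type) (ip : X -> X -> R) (Q : X -> X)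
    (x : X) : R :=
  Num.sqrt (ip (Q x) x).

Definition is_adjoint (R : realType) (X Y : vectType R)
    (ipX : X -> X -> R) (ipY : Y -> Y -> R) (L : 'Hom(X, Y)) (Ls : 'Hom(Y, X)) :
    Prop :=
  forall (x : X) (y : Y), ipY (L x) y = ipX x (Ls y).

Definition selfadjoint_psd (R : realType) (X : vectType R) (ip : X -> X -> R)
    (Q : 'End(X)) : Prop :=
  is_adjoint ip ip Q Q /\ forall x : X, 0 <= ip (Q x) x.

Definition psdmx (R : realType) (n : nat) (M : 'M[R]_n) : Prop :=
  M^T = M /\ forall u : 'cV[R]_n, 0 <= (u^T *m M *m u) 0 0.

Definition epigraph (R : realType) (X : vectType R) (f : X -> \bar R) :
    set (X * R^o) :=
  [set p | (f p.1 <= p.2%:E)%E].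

Definition proper_fun (R : realType) (X : vectType R) (f : X -> \bar R) : Prop :=
  (forall x, (-oo < f x)%E) /\ (exists x, (f x < +oo)%E).

(* A [vectType] carries no topology, so closedness of the epigraph is spelled
   out for the norm of the inner product: every adherent point belongs to it. *)
Definition closed_fun (R : realType) (X : vectType R) (ip : X -> X -> R)
    (f : X -> \bar R) : Prop :=
  forall (x : X) (t : R),
    (forall e : R, 0 < e -> exists p : X * R^o,
       [/\ epigraph f p, ipnorm ip (p.1 - x) < e & `|p.2 - t| < e]) ->
    epigraph f (x, t).

Definition convex_fun (R : realType) (X : vectType R) (f : X -> \bar R) : Prop :=
  convex_set (epigraph f : set (convex_lmodType (X * R^o)%type)).

Definition subdiff (R : realType) (X : vectType R) (ip : X -> X -> R)
    (f : X -> \bar R) (x : X) : set X :=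
  [set u | forall x', (f x + (ip u (x' - x))%:E <= f x')%E].

Definition minus_pt (R : realType) (X : vectType R) (S : set X) (a : X) : set X :=
  [set u - a | u in S].

Definition ip3 (R : realType) (X Y G : Type)
    (ipX : X -> X -> R) (ipY : Y -> Y -> R) (ipG : G -> G -> R)
    (z w : X * Y * G) : R :=
  ipX z.1.1 w.1.1 + ipY z.1.2 w.1.2 + ipG z.2 w.2.

Definition yop (R : realType) (Y G : vectType R)
    (H : 'End(Y)) (B : 'Hom(Y, G)) (Bs : 'Hom(G, Y)) (beta : R) (y : Y) : Y :=
  H y + beta *: Bs (B y).

Definition Mop (R : realType) (X Y G : vectType R)
    (H : 'End(Y)) (B : 'Hom(Y, G)) (Bs : 'Hom(G, Y)) (beta theta : R)
    (z : X * Y * G) : X * Y * G :=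
  (beta^-1 *: z.1.1, yop H B Bs beta z.1.2, (theta * beta)^-1 *: z.2).

Definition Top (R : realType) (X Y G : vectType R)
    (ipX : X -> X -> R) (ipY : Y -> Y -> R)
    (f : X -> \bar R) (g : Y -> \bar R)
    (A : 'Hom(X, G)) (As : 'Hom(G, X)) (B : 'Hom(Y, G)) (Bs : 'Hom(G, Y)) (b : G)
    (z : X * Y * G) : set (X * Y * G) :=
  minus_pt (subdiff ipX f z.1.1) (As z.2)
  `*` minus_pt (subdiff ipY g z.1.2) (Bs z.2)
  `*` [set A z.1.1 + B z.1.2 - b].

Definition zeros (Z : nmodType) (T : Z -> set Z) : set Z := [set z | T z 0].

Definition d0 (R : realType) (X Y G : vectType R)
    (ipX : X -> X -> R) (ipY : Y -> Y -> R) (ipG : G -> G -> R)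
    (T : X * Y * G -> set (X * Y * G)) (M : X * Y * G -> X * Y * G)
    (z0 : X * Y * G) : R :=
  inf [set opnorm (ip3 ipX ipY ipG) M (z - z0) ^+ 2 | z in zeros T].

Definition Gmx (R : realType) (tau1 theta sigma : R) : 'M[R]_2 :=
  let c := (1 - theta) * (sigma - 1 + (1 - tau1) * theta) in
  block_mx (sigma - 1 + (sigma - tau1) * theta)%:M c%:M
           c%:M (sigma - 1 + (2 - theta - tau1) * theta)%:M : 'M[R]_(1 + 1).

Definition mu (R : realType) (tau1 theta sigma : R) : R :=
  4 * (sigma - 1 + (1 - tau1) * theta) / theta `^ (3 / 2)
  * Num.max 1 (theta / (2 - theta)).

Definition theta_max (R : realType) (tau1 : R) : R :=
  (1 - 2 * tau1 + Num.sqrt ((1 - 2 * tau1) ^+ 2 + 4 * (1 - tau1)))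
  / (2 * (1 - tau1)).

Definition yobj (R : realType) (X Y G : vectType R)
    (ipY : Y -> Y -> R) (ipG : G -> G -> R) (g : Y -> \bar R)
    (A : 'Hom(X, G)) (B : 'Hom(Y, G)) (b : G) (H : 'End(Y)) (beta : R)
    (xt : X) (yprev : Y) (gammaprev : G) (y : Y) : \bar R :=
  (g y + (- ipG gammaprev (B y)
          + beta / 2 * ipnorm ipG (A xt + B y - b) ^+ 2
          + 1 / 2 * opnorm ipY H (y - yprev) ^+ 2)%:E)%E.

Definition argmin (R : realType) (Y : Type) (F : Y -> \bar R) : set Y :=
  [set y | forall y', (F y <= F y')%E].

(* The initial point is (x 0, y 0, gamma 0); v, xt (x tilde) and gammat
   (gamma tilde) are only meaningful at indices k >= 1. *)
Definition padmm (R : realType) (X Y G : vectType R)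
    (ipX : X -> X -> R) (ipY : Y -> Y -> R) (ipG : G -> G -> R)
    (f : X -> \bar R) (g : Y -> \bar R)
    (A : 'Hom(X, G)) (As : 'Hom(G, X)) (B : 'Hom(Y, G)) (b : G)
    (H : 'End(Y)) (beta tau1 tau2 theta : R)
    (x : nat -> X) (y : nat -> Y) (gamma : nat -> G)
    (v xt : nat -> X) (gammat : nat -> G) : Prop :=
  forall k : nat, (1 <= k)%N ->
  [/\ gammat k = gamma k.-1 - beta *: (A (xt k) + B (y k.-1) - b),
      minus_pt (subdiff ipX f (xt k)) (As (gammat k)) (v k)
      /\ ipnorm ipX (xt k - x k.-1 + beta *: v k) ^+ 2
         <= tau1 * ipnorm ipG (gammat k - gamma k.-1) ^+ 2
            + tau2 * ipnorm ipX (xt k - x k.-1) ^+ 2,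
      argmin (yobj ipY ipG g A B b H beta (xt k) (y k.-1) (gamma k.-1)) (y k),
      x k = x k.-1 - beta *: v k &
      gamma k = gamma k.-1 - (theta * beta) *: (A (xt k) + B (y k) - b)].

(* Main.v *)
(* With Z = X x Y x G seminormed by M, the method is a hybrid proximal
   extragradient iteration: M (z_{k-1} - z_k) lies in T (z~_k), where
   z~_k = (x~_k, y_k, gamma~_k), and for suitable eta_k >= 0
     |z~_k - z_k|^2 + eta_k <= sigma |z~_k - z_{k-1}|^2 + eta_{k-1}.
   Monotonicity of T makes |z_k - zs|^2 + eta_k decrease by at least
   (1 - sigma) |z~_k - z_{k-1}|^2 for each zero zs of T, so the squares
   |z_{k-1} - z_k|^2 are summable with an explicit bound and the smallest of
   the first k is at most the average.

   For k >= 2 the relaxed error condition comes from comparing the optimality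
   conditions of two successive y-subproblems, which trades the cross term
   <gamma_k - gamma_{k-1}, B (y_k - y_{k-1})> for one that G_sigma controls.
   There is no previous subproblem for k = 1; there the cross term is bounded by
   the distance of z_0 to zs, whence the constant mu. *)
Require Import Defs.
From HB Require Import structures.
From mathcomp Require Import all_boot all_order all_algebra.
From mathcomp Require Import sesquilinear ring lra.
From mathcomp Require Import all_classical all_reals all_analysis.

Set Implicit Arguments.
Unset Strict Implicit.
Unset Printing Implicit Defensive.

Import Order.TTheory GRing.Theory Num.Theory.
Local Open Scope classical_set_scope.
Local Open Scope ring_scope.

(** * Semidefinite forms and the abstract hybrid proximal extragradient estimate *)

(* Semidefinite only: <Mz, w> may be degenerate in y. *)
Record psd_form (R : realType) (V : lmodType R) (q : V -> V -> R) : Prop :=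
  PsdForm {
    psd_linearl : forall a u v w, q (a *: u + v) w = a * q u w + q v w;
    psdC : forall u v, q u v = q v u;
    psd_ge0 : forall u, 0 <= q u u }.

Section PsdForm.
Variables (R : realType) (V : lmodType R) (q : V -> V -> R).
Hypothesis hq : psd_form q.

Lemma psdDl u v w : q (u + v) w = q u w + q v w.
Proof. by rewrite -[u]scale1r (psd_linearl hq) mul1r scale1r. Qed.

Lemma psd0l w : q 0 w = 0.
Proof. by apply: (@addrI _ (q 0 w)); rewrite -psdDl !addr0. Qed.

Lemma psdZl a u w : q (a *: u) w = a * q u w.
Proof. by rewrite -[a *: u]addr0 (psd_linearl hq) psd0l addr0. Qed.

Lemma psdNl u w : q (- u) w = - q u w.
Proof. by rewrite -scaleN1r psdZl mulN1r. Qed.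

Lemma psdDr u v w : q w (u + v) = q w u + q w v.
Proof. by rewrite !(psdC hq w) psdDl. Qed.

Lemma psdZr a u w : q w (a *: u) = a * q w u.
Proof. by rewrite !(psdC hq w) psdZl. Qed.

Lemma psdNr u w : q w (- u) = - q w u.
Proof. by rewrite !(psdC hq w) psdNl. Qed.

Definition psdE := (psdDl, psdNl, psdZl, psdDr, psdNr, psdZr).

Lemma psd_sqD_le u v : q (u + v) (u + v) <= 2 * q u u + 2 * q v v.
Proof.
have := psd_ge0 hq (u - v); rewrite !psdE (psdC hq v u); lra.
Qed.

Lemma psd_young (s : R) u v : 2 * s * q u v <= s ^+ 2 * q u u + q v v.
Proof.
have := psd_ge0 hq (s *: u - v); rewrite !psdE (psdC hq v u); lra.
Qed.

(** Completing the square: with [p = a *: u + b *: v], the expression times [a] is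
    [q p p + (a * c - b ^+ 2) * q v v]. This carries positivity of the 2x2 matrix [G_sigma] over to
    vector arguments. *)
Lemma psd_mx2 (a b c : R) u v : 0 < a -> b ^+ 2 <= a * c ->
  0 <= a * q u u + 2 * b * q u v + c * q v v.
Proof.
move=> a0 bac; rewrite -(pmulr_rge0 _ a0).
have := psd_ge0 hq (a *: u + b *: v); rewrite !psdE (psdC hq v u) => h1.
have : 0 <= (a * c - b ^+ 2) * q v v.
  by rewrite mulr_ge0 ?subr_ge0 ?(psd_ge0 hq).
lra.
Qed.

(** The right side minus the left side is exactly [2 * q (z0 - z1) (zt - zs)]. *)
Lemma hpe_fejer z0 z1 zt zs : 0 <= q (z0 - z1) (zt - zs) ->
  q (z1 - zs) (z1 - zs) + q (zt - z0) (zt - z0)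
  <= q (z0 - zs) (z0 - zs) + q (zt - z1) (zt - z1).
Proof.
rewrite !psdE (psdC hq zs z1) (psdC hq zs z0) (psdC hq zt z0) (psdC hq zt z1).
lra.
Qed.

(** Each squared step is at most [2 * e1 + 2 * e0]; the error condition eliminates [e1] and the
    Fejer inequality bounds [(1 - sigma) * e0]. The increments of [eta] then carry the factor 2 (1 +
    sigma) + 2 (1 - sigma) = 4. *)
Lemma hpe_sum (sigma : R) (z zt : nat -> V) (eta : nat -> R) zs :
  0 <= sigma < 1 ->
  (forall k, 0 <= q (z k - z k.+1) (zt k.+1 - zs)) ->
  (forall k, 0 <= eta k) ->
  (forall k, q (zt k.+1 - z k.+1) (zt k.+1 - z k.+1) + eta k.+1
     <= sigma * q (zt k.+1 - z k) (zt k.+1 - z k) + eta k) ->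
  forall n,
  (1 - sigma) * (\sum_(i < n) q (z i - z i.+1) (z i - z i.+1))
  <= 2 * (1 + sigma) * q (z 0%N - zs) (z 0%N - zs) + 4 * eta 0%N.
Proof.
move=> /andP[s0 s1] hmono eta0 hstep n.
pose D k := q (z k - zs) (z k - zs).
(* The terms at index [n] are kept so that the induction telescopes. *)
suff : (1 - sigma) * (\sum_(i < n) q (z i - z i.+1) (z i - z i.+1))
    <= 2 * (1 + sigma) * (D 0%N - D n) + 4 * (eta 0%N - eta n).
  have : 0 <= (1 + sigma) * D n.
    by apply: mulr_ge0; [lra | exact: (psd_ge0 hq)].
  have := eta0 n; rewrite -/(D 0%N); lra.
elim: n => [|n IH]; first by rewrite big_ord0; lra.
rewrite big_ord_recr /= mulrDr.
have := psd_sqD_le (zt n.+1 - z n.+1) (- (zt n.+1 - z n)).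
have -> : zt n.+1 - z n.+1 - (zt n.+1 - z n) = z n - z n.+1.
  by rewrite opprB addrC addrA subrK.
rewrite psdNl psdNr opprK => h1.
have := hpe_fejer (hmono n); rewrite -/(D n) -/(D n.+1).
have := hstep n; move: IH h1.
move: (q (zt n.+1 - z n.+1) _) (q (zt n.+1 - z n) _) (q (z n - z n.+1) _)
  => e1 e0 d IH h1 h2 h3.
have h4 : (1 - sigma) * d <= (1 - sigma) * (2 * (1 + sigma) * e0 + 2 * (eta n - eta n.+1)).
  by rewrite ler_pM2l; lra.
have : (1 + sigma) * ((1 - sigma) * e0)
    <= (1 + sigma) * (D n - D n.+1 + eta n - eta n.+1).
  by rewrite ler_pM2l; lra.
lra.
Qed.

End PsdForm.

(** * Convexity and the optimality condition of the y-subproblem *)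

Lemma vect_dot_psd (R : realType) (X : vectType R) (ip : {dot X for idfun}) :
  psd_form (ip : X -> X -> R).
Proof.
split.
- by move=> a u v w; rewrite linearDl linearZl_LR.
- by move=> u v; rewrite hermC expr0 mul1r.
- move=> u; have [->|u0] := eqVneq u 0; first by rewrite linear0r.
  by rewrite ltW //; apply: neq0_dnorm_gt0.
Qed.

Lemma convex_fun_segment (R : realType) (X : vectType R) (f : X -> \bar R)
    (x x' : X) (a a' t : R) :
  convex_fun f -> 0 <= t <= 1 -> (f x <= a%:E)%E -> (f x' <= a'%:E)%E ->
  (f (x + t *: (x' - x))%R <= (a + t * (a' - a))%:E)%E.
Proof.
move=> cf /andP[t0 t1] fx fx'.
have := cf (x', a') (x, a) (Itv01 t0 t1) (mem_set fx') (mem_set fx).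
move/set_mem; rewrite /epigraph /= /conv /=.
rewrite /unstable.onem.
have -> : t *: x' + (1 - t) *: x = x + t *: (x' - x).
  by rewrite scalerBl scale1r scalerBr addrCA.
suff -> : t *: (a' : R^o) + (1 - t) *: (a : R^o) = a + t * (a' - a) by [].
by rewrite /GRing.scale /=; ring.
Qed.

Lemma le0_of_quadratic (R : realFieldType) (a c : R) : 0 <= c ->
  (forall t : R, 0 < t <= 1 -> 0 <= t * a + t ^+ 2 * c) -> 0 <= a.
Proof.
move=> c0 h; rewrite leNgt; apply/negP => a0.
have ca : 0 < c - a by lra.
(* This [t] lies in ]0, 1] and gives the negative value [(a / (c - a)) ^+ 2 * a], which replaces a
   limit t -> 0. *)
have := h (- a / (c - a)).
rewrite divr_gt0 ?oppr_gt0 // ler_pdivrMr // mul1r.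
have -> : - a <= c - a by lra.
have -> : - a / (c - a) * a + (- a / (c - a)) ^+ 2 * c = (a / (c - a)) ^+ 2 * a.
  field; lra.
move=> /(_ isT); rewrite pmulr_rge0 ?leNgt ?a0 //.
by rewrite exprn_even_gt0 //= mulf_neq0 ?invr_eq0 //; lra.
Qed.

Lemma selfadjoint_psd_form (R : realType) (Y : vectType R)
    (ipY : {dot Y for idfun}) (H : 'End(Y)) :
  selfadjoint_psd ipY H -> psd_form (fun y y' => ipY (H y) y').
Proof.
move=> [Hsa Hge0]; have hY := vect_dot_psd ipY; split.
- by move=> a u v w /=; rewrite linearP (psd_linearl hY).
- by move=> u v /=; rewrite Hsa (psdC hY).
- exact: Hge0.
Qed.

(** First-order optimality along the segment from [y1] to [y']. The multiplier is taken at [yp]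
    rather than [y1]; the discrepancy [beta *: Bs (B (yp - y1))] is the second term of [yop]. *)
Lemma argmin_subdiff (R : realType) (X Y G : vectType R)
    (ipY : {dot Y for idfun}) (ipG : {dot G for idfun}) (g : Y -> \bar R)
    (A : 'Hom(X, G)) (B : 'Hom(Y, G)) (Bs : 'Hom(G, Y)) (b : G) (H : 'End(Y))
    (beta : R) (xt : X) (yp : Y) (gp : G) (y1 : Y) :
  proper_fun g -> convex_fun g -> is_adjoint ipY ipG B Bs ->
  selfadjoint_psd ipY H -> 0 < beta ->
  argmin (yobj ipY ipG g A B b H beta xt yp gp) y1 ->
  minus_pt (subdiff ipY g y1) (Bs (gp - beta *: (A xt + B yp - b)))
    (yop H B Bs beta (yp - y1)).
Proof.
move=> [gNoo [y0 gy0]] cg Badj Hpsd beta0 ymin.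
have hY := vect_dot_psd ipY; have hG := vect_dot_psd ipG.
have hH := selfadjoint_psd_form Hpsd.
have ipGE u : ipnorm ipG u ^+ 2 = ipG u u.
  by rewrite sqr_sqrtr // (psd_ge0 hG).
have ipHE u : opnorm ipY H u ^+ 2 = ipY (H u) u.
  by rewrite sqr_sqrtr // (psd_ge0 hH).
set u := yop H B Bs beta (yp - y1) + Bs (gp - beta *: (A xt + B yp - b)).
exists u; last by rewrite /u addrK.
have fin y : (g y < +oo)%E -> exists r, g y = r%:E.
  by move: (gNoo y); case: (g y) => // r; exists r.
have [r gy1] : exists r, g y1 = r%:E.
  have := ymin y0; rewrite /yobj.
  have [r0 ->] := fin _ gy0.
  by move: (gNoo y1); case: (g y1) => [r1||] // _ _; exists r1.
move=> y'; have [gy'|] := ltP (g y') +oo%E; last first.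
  by rewrite leye_eq => /eqP ->; rewrite leey.
have [r' gy'E] := fin _ gy'.
rewrite gy1 gy'E -EFinD lee_fin.
set d := y' - y1.
suff : 0 <= r' - r - ipY u d by lra.
(* The constant is the coefficient of t^2 in the quadratic part of the objective; by convexity [g]
   contributes at most a term linear in [t]. *)
apply: (@le0_of_quadratic _ _ (beta / 2 * ipG (B d) (B d) + 2^-1 * ipY (H d) d)).
  apply: addr_ge0; apply: mulr_ge0; rewrite ?(psd_ge0 hG) ?(psd_ge0 hH) //; lra.
move=> t /andP[t0 t1].
have gt : (g (y1 + t *: d)%R <= (r + t * (r' - r))%:E)%E.
  by apply: convex_fun_segment; rewrite ?gy1 ?gy'E // ltW.
clearbody d.
have := le_trans (ymin (y1 + t *: d)) (leeD2r _ gt).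
rewrite /yobj gy1 -!EFinD lee_fin !ipGE !ipHE.
have -> : ipY u d = ipY (H (yp - y1)) d + beta * ipG (B (yp - y1)) (B d)
   + ipG (gp - beta *: (A xt + B yp - b)) (B d).
  rewrite /u /yop !(psdDl hY) (psdZl hY).
  by rewrite !(psdC hY (Bs _)) -!Badj !(psdC hG (B d)).
have -> : y1 + t *: d - yp = (y1 - yp) + t *: d by rewrite addrAC.
have -> : H (yp - y1) = - H (y1 - yp) by rewrite -linearN opprB.
have -> : H (y1 - yp + t *: d) = H (y1 - yp) + t *: H d.
  by rewrite linearD linearZ.
have -> : B (y1 + t *: d) = B y1 + t *: B d by rewrite linearD linearZ.
have -> : B (yp - y1) = B yp - B y1 by rewrite linearB.
have hHC := psdC hH d (y1 - yp); move: hHC => /= hHC.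
move: (y1 - yp) hHC => e hHC.
rewrite !(psdE hY) !(psdE hG) hHC.
move: (B d) (B y1) (A xt) (B yp) => bd b1 ax bp.
rewrite !(psdC hG bd) (psdC hG b1 ax) (psdC hG b ax) (psdC hG b b1).
lra.
Qed.

(** * The stepsize range and the choice of sigma *)

(** [theta_max] is the larger root of the quadratic: with [s] and [y] as below, [(s - y) * (s + y)]
    is 4 (1 - tau1) times the claimed expression. *)
Lemma theta_max_quadratic (R : realType) (tau1 theta : R) :
  0 <= tau1 < 1 -> 0 < theta < theta_max tau1 ->
  0 < 1 + theta * (1 - 2 * tau1) - theta ^+ 2 * (1 - tau1).
Proof.
move=> /andP[t0 t1] /andP[th0]; rewrite /theta_max.
set a := 1 - 2 * tau1; have aE : a = 1 - 2 * tau1 by [].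
clearbody a; set D := _ ^+ 2 + _; set s := Num.sqrt D.
have D0 : 0 <= D by rewrite addr_ge0 ?sqr_ge0 //; lra.
have sD : s ^+ 2 = D by rewrite sqr_sqrtr.
have s0 : 0 <= s by exact: sqrtr_ge0.
have p0 : 0 < 1 - tau1 by lra.
rewrite ltr_pdivlMr; last lra.
move=> h.
have asq : `|a| <= s by rewrite -ler_sqr ?nnegrE // real_normK ?num_real // sD /D; lra.
have ha := ler_norm a.
set y := 2 * (1 - tau1) * theta - a.
have y1 : 0 < s - y by rewrite /y; move: h; lra.
have y2 : 0 < s + y.
  have : 0 < (1 - tau1) * theta by apply: mulr_gt0.
  rewrite /y; lra.
have := mulr_gt0 y1 y2.
have -> : (s - y) * (s + y) = s ^+ 2 - y ^+ 2 by ring.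
rewrite sD /D /y => h2.
rewrite -(pmulr_rgt0 _ p0); lra.
Qed.

(** For [theta >= 2] the preceding quadratic is at most [1 - theta]. *)
Lemma theta_lt2 (R : realType) (tau1 theta : R) :
  0 <= tau1 < 1 -> 0 < theta < theta_max tau1 -> theta < 2.
Proof.
move=> ht hth; have := theta_max_quadratic ht hth.
move: ht hth => /andP[t0 t1] /andP[th0 _] q0; rewrite ltNge; apply/negP => th2.
have : 0 <= (theta - 2) * (theta * (1 - tau1)) by rewrite !mulr_ge0; lra.
lra.
Qed.

(** [g11] and [g22] are the diagonal of [G_sigma]; the off-diagonal entry is [(1 - theta) * gcross],
    and [gcross] is also a factor of [mu]. *)
Definition g11 (R : realType) (tau1 theta sigma : R) :=
  sigma - 1 + (sigma - tau1) * theta.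
Definition g22 (R : realType) (tau1 theta sigma : R) :=
  sigma - 1 + (2 - theta - tau1) * theta.
Definition gcross (R : realType) (tau1 theta sigma : R) :=
  sigma - 1 + (1 - tau1) * theta.

(* sigma = 1 - e with e small: at sigma = 1 the determinant of G_sigma is
   (1 - tau1) theta^2 (1 + (1 - 2 tau1) theta - (1 - tau1) theta^2), which is
   positive exactly because theta < theta_max. The last condition is needed only
   for the first iteration. *)
Lemma exists_sigma (R : realType) (tau1 tau2 theta : R) :
  0 <= tau1 < 1 -> 0 <= tau2 < 1 -> 0 < theta < theta_max tau1 ->
  exists sigma : R,
    [/\ 0 < sigma < 1, tau2 <= sigma,
        0 < g11 tau1 theta sigma /\ 0 <= gcross tau1 theta sigma,
        ((1 - theta) * gcross tau1 theta sigma) ^+ 2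
          <= g11 tau1 theta sigma * g22 tau1 theta sigma &
        (gcross tau1 theta sigma - sigma * theta) * Num.sqrt theta
          <= gcross tau1 theta sigma].
Proof.
move=> ht1 /andP[t20 t21] hth.
have q0 := theta_max_quadratic ht1 hth; have th2 := theta_lt2 ht1 hth.
move: ht1 hth => /andP[t10 t11] /andP[th0 _].
pose p := (1 - tau1) * theta; pose s := (2 - theta - tau1) * theta.
have p0 : 0 < p by rewrite mulr_gt0 // subr_gt0.
pose delta := p * s - ((1 - theta) * p) ^+ 2.
have delta0 : 0 < delta.
  have -> : delta = p * theta * (1 + theta * (1 - 2 * tau1) - theta ^+ 2 * (1 - tau1)).
    by rewrite /delta /p /s; ring.
  by apply: mulr_gt0 => //; apply: mulr_gt0.
(* At sigma = 1 - e the determinant is delta - e K + e^2 theta (3 - theta). *)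
pose K := p + (1 + theta) * s - 2 * (1 - theta) ^+ 2 * p.
(* In order, the bounds serve the last condition together with sigma > 0, then [tau2 <= sigma], the
   signs of [g11] and [gcross], and the determinant. *)
pose e := Num.min (Num.min (3^-1) (1 - tau2))
  (Num.min (p / (2 * (1 + theta))) (delta / (`|K| + 1))).
have K0 : 0 < `|K| + 1 by rewrite ltr_wpDl.
have e0 : 0 < e.
  by rewrite !lt_min invr_gt0 ltr0n subr_gt0 t21 !divr_gt0 //; lra.
have [e1 [e2 [e3 e4]]] : e <= 3^-1 /\ e <= 1 - tau2 /\ e * (2 * (1 + theta)) <= p
    /\ e * (`|K| + 1) <= delta.
  have : e <= e by []. 
  rewrite {2}/e !le_min -!andbA => /and4P[? ? ? ?].
  by rewrite -!ler_pdivlMr //; lra.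
have et0 : 0 < e * theta by rewrite mulr_gt0.
exists (1 - e).
have g11E : g11 tau1 theta (1 - e) = p - e * (1 + theta) by rewrite /g11 /p; ring.
have g22E : g22 tau1 theta (1 - e) = s - e by rewrite /g22 /s; ring.
have gcE : gcross tau1 theta (1 - e) = p - e by rewrite /gcross /p; ring.
rewrite g11E g22E gcE; split; [lra | lra | split; lra | | ].
- have hK : e * K <= delta.
    apply: le_trans e4; rewrite ler_pM2l //.
    by apply: le_trans (ler_norm _) _; lra.
  have : 0 <= e ^+ 2 * (theta * (3 - theta)).
    by rewrite !mulr_ge0 ?sqr_ge0 //; lra.
  move: hK; rewrite /K /delta; lra.
(* The factor [gcross - sigma * theta] equals -tau1 theta + e (theta - 1), so it is nonpositive when
   [theta <= 1]. *)
- have [th1|th1] := leP theta 1.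
    have : (p - e - (1 - e) * theta) * Num.sqrt theta <= 0.
      apply: mulr_le0_ge0; last exact: sqrtr_ge0.
      have : 0 <= tau1 * theta by rewrite mulr_ge0 // ltW.
      have : 0 <= e * (1 - theta) by rewrite mulr_ge0 //; lra.
      rewrite /p; lra.
    lra.
  have [neg|pos] := leP (p - e - (1 - e) * theta) 0.
    have : (p - e - (1 - e) * theta) * Num.sqrt theta <= 0.
      by apply: mulr_le0_ge0 => //; exact: sqrtr_ge0.
    lra.
  have sq : Num.sqrt theta <= theta.
    rewrite -ler_sqr ?nnegrE ?sqrtr_ge0 ?(ltW th0) // sqr_sqrtr ?(ltW th0) //.
    by rewrite expr2 ler_peMr // ltW.
  apply: (@le_trans _ _ ((p - e - (1 - e) * theta) * theta)).
    by rewrite ler_pM2l.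
  have : 0 <= tau1 * (theta * (theta - 1)) by rewrite !mulr_ge0 //; lra.
  (* For 1 < theta < 2, [e <= 3^-1] yields e (theta^2 - theta + 1) <= theta. *)
  have : 0 <= (3^-1 - e) * (theta ^+ 2 - theta + 1).
    rewrite mulr_ge0 ?subr_ge0 //.
    have : 0 <= theta * (theta - 1) by rewrite mulr_ge0 //; lra.
    lra.
  have : 0 <= theta * (2 - theta) by rewrite mulr_ge0 //; lra.
  rewrite /p; lra.
Qed.

Lemma Gmx_psd (R : realType) (tau1 theta sigma : R) :
  0 < g11 tau1 theta sigma ->
  ((1 - theta) * gcross tau1 theta sigma) ^+ 2
    <= g11 tau1 theta sigma * g22 tau1 theta sigma ->
  psdmx (Gmx tau1 theta sigma).
Proof.
move=> g0 det.
have -> : Gmx tau1 theta sigma = @block_mx R 1 1 1 1 (g11 tau1 theta sigma)%:M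
    ((1 - theta) * gcross tau1 theta sigma)%:M
    ((1 - theta) * gcross tau1 theta sigma)%:M
    (g22 tau1 theta sigma)%:M :> 'M[R]_(1 + 1) by [].
split; first by rewrite (@tr_block_mx R 1 1 1 1) !tr_scalar_mx.
move=> u; have := @vsubmxK R 1 1 1 u.
move: (@usubmx R 1 1 1 u) (@dsubmx R 1 1 1 u) => u1 u2 <-.
rewrite (@tr_col_mx R 1 1 1) (@mul_row_block R 1 1 1 1 1) (@mul_row_col R 1 1 1 1).
rewrite !mul_mx_scalar !mulmxDl -!scalemxAl !mxE !big_ord1 !mxE.
set a := u1 _ _; set c := u2 _ _.
have hq : psd_form (fun a b : R^o => a * b : R).
  split; [by move=> *; rewrite /GRing.scale /=; ring | exact: mulrC|].
  by move=> x; rewrite -expr2 sqr_ge0.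
have := psd_mx2 hq a c g0 det; lra.
Qed.

Lemma mu_sqrt (R : realType) (tau1 theta sigma : R) : 0 < theta ->
  mu tau1 theta sigma = 4 * gcross tau1 theta sigma / (theta * Num.sqrt theta)
    * Num.max 1 (theta / (2 - theta)).
Proof.
move=> th0; rewrite /mu; congr (_ / _ * _).
have -> : 3 / 2 = 1 + 2^-1 :> R by field.
by rewrite powRD ?powRr1 ?powR12_sqrt ?ltW // gt_eqF ?implybT.
Qed.

(** * The relaxed error condition as inequalities between scalars *)

(* Here r = A x~_k + B y_k - b, w = B (y_k - y_{k-1}), h = |y_k - y_{k-1}|_H^2,
   and E1, E2 are |x~_k - x_{k-1}|^2 / beta and |x~_k - x_k|^2 / beta, so that n0
   and n1 are theta |z~_k - z_{k-1}|^2 and theta |z~_k - z_k|^2. *)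
Section ErrorCondition.
Variables (R : realType) (V : lmodType R) (ip : V -> V -> R).
Hypothesis hip : psd_form ip.
Variables (tau1 tau2 theta sigma beta : R).
Hypothesis (ht1 : 0 <= tau1 < 1) (ht2 : 0 <= tau2 < 1) (th0 : 0 < theta).
Hypothesis (s01 : 0 < sigma < 1) (ht2s : tau2 <= sigma) (beta0 : 0 < beta).
Hypothesis (hg11 : 0 < g11 tau1 theta sigma) (hc0 : 0 <= gcross tau1 theta sigma).
Hypothesis hdet : ((1 - theta) * gcross tau1 theta sigma) ^+ 2
  <= g11 tau1 theta sigma * g22 tau1 theta sigma.
Variables (r w : V) (h E1 E2 : R).
Hypothesis (h0 : 0 <= h) (E10 : 0 <= E1).
Hypothesis hE : E2 <= tau1 * (beta * ip (r - w) (r - w)) + tau2 * E1.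

Let n1 := theta * E2 + beta * ip (w - (1 - theta) *: r) (w - (1 - theta) *: r).
Let n0 := theta * E1 + theta * h + theta * (beta * ip w w) + beta * ip (r - w) (r - w).

(** Expansion gives sigma n0 - n1 >= beta (g11 |w|^2 - 2 gcross <r, w> + g22 |r|^2) + sigma theta h.
    Adding [hmono] with weight 2 gcross trades <r, w> for <rp, w>, which the [G_sigma] form at (w,
    rp), that is [f5], absorbs. *)
Lemma admm_step (rp : V) (hp s : R) :
  s <= (h + hp) / 2 ->
  0 <= beta * (1 - theta) * ip rp w - beta * ip r w - h + s ->
  n1 + (g22 tau1 theta sigma * (beta * ip r r) + gcross tau1 theta sigma * h)
  <= sigma * n0
     + (g22 tau1 theta sigma * (beta * ip rp rp) + gcross tau1 theta sigma * hp).
Proof.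
move=> hs hmono; have /andP[s0 _] := s01.
have f1 : 0 <= theta * (tau1 * (beta * ip (r - w) (r - w)) + tau2 * E1 - E2).
  by rewrite mulr_ge0 ?subr_ge0 // ltW.
have f2 : 0 <= theta * ((sigma - tau2) * E1).
  by rewrite !mulr_ge0 ?subr_ge0 // ltW.
have f3 := mulr_ge0 hc0 hmono.
have f4 : 0 <= gcross tau1 theta sigma * ((h + hp) / 2 - s).
  by rewrite mulr_ge0 ?subr_ge0.
have det' : (- ((1 - theta) * gcross tau1 theta sigma)) ^+ 2
  <= g11 tau1 theta sigma * g22 tau1 theta sigma by rewrite sqrrN.
have f5 := mulr_ge0 (ltW beta0) (psd_mx2 hip w rp hg11 det').
have f6 : 0 <= sigma * theta * h by rewrite !mulr_ge0 // ltW.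
move: f1 f2 f3 f4 f5 f6; rewrite /n1 /n0 !(psdE hip) (psdC hip w r) (psdC hip w rp).
rewrite /g11 /g22 /gcross; lra.
Qed.

Lemma g22_ge0 : 0 <= g22 tau1 theta sigma.
Proof. by rewrite -(pmulr_rge0 _ hg11) (le_trans _ hdet) ?sqr_ge0. Qed.

Hypothesis th2 : theta < 2.
Hypothesis hsqrt : (gcross tau1 theta sigma - sigma * theta) * Num.sqrt theta
  <= gcross tau1 theta sigma.
Variables (D0 D1 : R).
Hypothesis (D00 : 0 <= D0).
Hypothesis hfejer : theta * D1 + n0 <= theta * D0 + n1.
Hypothesis hdist : h + beta * ip w w + theta * (beta * ip r r) <= 2 * D0 + 2 * D1.

Let m := Num.max 1 (theta / (2 - theta)).

(** [hfejer] yields D1 <= D0 + (theta - 1) beta |r|^2. If theta <= 1, then D1 <= D0; otherwise the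
    excess is absorbed by the left side S, leaving (2 - theta) S <= 4 theta D0. Hence the maximum
    [m]. *)
Lemma admm_first_dist :
  h + beta * ip w w + theta * (beta * ip r r) <= 4 * m * D0.
Proof.
set S := (X in X <= _); have /andP[_ t11] := ht1; have /andP[_ t21] := ht2.
have brr : 0 <= beta * ip r r by rewrite mulr_ge0 ?(psd_ge0 hip) // ltW.
have bww : 0 <= beta * ip w w by rewrite mulr_ge0 ?(psd_ge0 hip) // ltW.
have m1 : 1 <= m by rewrite /m le_max lexx.
have m2 : theta <= m * (2 - theta).
  by rewrite -ler_pdivrMr ?subr_gt0 // /m le_max lexx orbT.
have mD : D0 <= m * D0 by rewrite ler_peMl.
have hD : D1 <= D0 + (theta - 1) * (beta * ip r r).
  rewrite -(ler_pM2l th0); move: hfejer; rewrite /n0 /n1.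
  have f1 : 0 <= theta * (tau1 * (beta * ip (r - w) (r - w)) + tau2 * E1 - E2).
    by rewrite mulr_ge0 ?subr_ge0 // ltW.
  have f2 : 0 <= theta * ((1 - tau2) * E1).
    by rewrite !mulr_ge0 ?subr_ge0 // ltW.
  have f3 : 0 <= theta * ((1 - tau1) * (beta * ip (r - w) (r - w))).
    by rewrite !mulr_ge0 ?subr_ge0 ?(psd_ge0 hip) // ltW.
  have f4 : 0 <= theta * h by rewrite mulr_ge0 // ltW.
  move: f1 f2 f3 f4; rewrite !(psdE hip) (psdC hip w r); lra.
have [th1|th1] := leP theta 1.
  have : 0 <= (1 - theta) * (beta * ip r r) by rewrite mulr_ge0 ?subr_ge0.
  rewrite /S; move: hdist hD mD; lra.
have tS : theta * (beta * ip r r) <= S by rewrite /S; move: h0 bww; lra.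
have : (theta - 1) * (theta * (beta * ip r r)) <= (theta - 1) * S.
  by rewrite ler_pM2l ?subr_gt0.
have : theta * S <= theta * (4 * D0 + 2 * ((theta - 1) * (beta * ip r r))).
  by rewrite ler_pM2l // /S; move: hdist hD; lra.
have : theta * D0 <= m * (2 - theta) * D0 by rewrite ler_wpM2r.
rewrite -[S <= _](@ler_pM2l _ (2 - theta)) ?subr_gt0 //; lra.
Qed.

(** Without a previous residual, the cross term is bounded by 2 sqrt(theta) <r, w> <= theta |r|^2 +
    |w|^2 and then by [admm_first_dist]; this weight produces theta^(3/2) in [mu]. [hsqrt] handles
    the terms in [h]. *)
Lemma admm_first_step :
  n1 + (g22 tau1 theta sigma * (beta * ip r r) + gcross tau1 theta sigma * h)
  <= sigma * n0 + theta * (mu tau1 theta sigma * D0).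
Proof.
have := admm_first_dist; rewrite mu_sqrt // -/m.
set S := (X in X <= _) => hS.
set c := gcross tau1 theta sigma; set s := Num.sqrt theta.
have s0 : 0 < s by rewrite sqrtr_gt0.
have sE : s ^+ 2 = theta by rewrite sqr_sqrtr // ltW.
have muE : s * (theta * (4 * c / (theta * s) * m * D0)) = c * (4 * m * D0).
  by field; rewrite !gt_eqF.
have f0 : c * S <= s * (theta * (4 * c / (theta * s) * m * D0)).
  by rewrite muE ler_wpM2l.
have f1 : 0 <= s * (theta * (tau1 * (beta * ip (r - w) (r - w)) + tau2 * E1 - E2)).
  by rewrite !mulr_ge0 ?subr_ge0 // ltW.
have f2 : 0 <= s * (theta * ((sigma - tau2) * E1)).
  by rewrite !mulr_ge0 ?subr_ge0 // ltW.
have f3 : 0 <= (c * beta) * (theta * ip r r + ip w w - 2 * s * ip r w).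
  rewrite mulr_ge0 ?subr_ge0 ?mulr_ge0 ?(ltW beta0) //.
  by rewrite -sE; exact: psd_young.
have f4 : 0 <= (c - (c - sigma * theta) * s) * h.
  by rewrite mulr_ge0 // subr_ge0.
have f5 : 0 <= s * (g11 tau1 theta sigma * (beta * ip w w)).
  by rewrite !mulr_ge0 ?(psd_ge0 hip) // ltW.
rewrite -(ler_pM2l s0) [leRHS]mulrDr; move: f0.
move: (s * (theta * (4 * c / _ * _ * _))) => Q.
move: f1 f2 f3 f4 f5; rewrite /n1 /n0 /S !(psdE hip) (psdC hip w r).
rewrite /c /g11 /g22 /gcross; lra.
Qed.

End ErrorCondition.

(** * Monotonicity and the inclusions satisfied by the iterates *)

Lemma subdiff_mono (R : realType) (X : vectType R) (ip : {dot X for idfun})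
    (f : X -> \bar R) (x x' u u' a a' : X) :
  proper_fun f -> minus_pt (subdiff ip f x) a u ->
  minus_pt (subdiff ip f x') a' u' ->
  0 <= ip (u + a - (u' + a')) (x - x').
Proof.
move=> [fNoo [x0 fx0]] [p hp <-] [p' hp' <-]; rewrite !subrK.
have hX := vect_dot_psd ip.
(* Having a subgradient forces a finite value, because [f] is finite at [x0]. *)
have fin y s : subdiff ip f y s -> exists r, f y = r%:E.
  move=> /(_ x0); move: (fNoo y) (fNoo x0) fx0.
  by case: (f y) => [r| |] //; [exists r | case: (f x0)].
have [r fx] := fin _ _ hp; have [r' fx'] := fin _ _ hp'.
have := hp x'; have := hp' x; rewrite fx fx' -!EFinD !lee_fin.
rewrite !(psdE hX); lra.
Qed.

Section Admm.
Variables (R : realType) (X Y G : vectType R).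
Variables (ipX : {dot X for idfun}) (ipY : {dot Y for idfun}) (ipG : {dot G for idfun}).
Variables (f : X -> \bar R) (g : Y -> \bar R).
Variables (A : 'Hom(X, G)) (As : 'Hom(G, X)) (B : 'Hom(Y, G)) (Bs : 'Hom(G, Y)).
Variables (b : G) (H : 'End(Y)) (beta theta : R).
Hypothesis hA : is_adjoint ipX ipG A As.
Hypothesis hB : is_adjoint ipY ipG B Bs.
Hypothesis hH : selfadjoint_psd ipY H.
Hypothesis (beta0 : 0 < beta) (theta0 : 0 < theta).

Let hX := vect_dot_psd ipX.
Let hY := vect_dot_psd ipY.
Let hG := vect_dot_psd ipG.
Let hHf := selfadjoint_psd_form hH.

Definition mform (z w : X * Y * G) : R :=
  ip3 ipX ipY ipG (Mop H B Bs beta theta z) w.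

Lemma yopE y y' : ipY (yop H B Bs beta y) y' = ipY (H y) y' + beta * ipG (B y) (B y').
Proof. by rewrite /yop (psdDl hY) (psdZl hY) (psdC hY (Bs _)) -hB (psdC hG). Qed.

Lemma mformE z w : mform z w = beta^-1 * ipX z.1.1 w.1.1
  + (ipY (H z.1.2) w.1.2 + beta * ipG (B z.1.2) (B w.1.2))
  + (theta * beta)^-1 * ipG z.2 w.2.
Proof. by rewrite /mform /ip3 /= (psdZl hX) (psdZl hG) yopE. Qed.

Lemma mform_psd : psd_form mform.
Proof.
split.
- move=> a u v w; rewrite !mformE /= !linearP /= !(psd_linearl hX) !(psd_linearl hY).
  rewrite !(psd_linearl hG); ring.
- move=> u v; rewrite !mformE (psdC hX) (psdC hG u.2) (psdC hG (B u.1.2)).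
  by have /= -> := psdC hHf u.1.2 v.1.2.
- move=> u; rewrite mformE !addr_ge0 ?mulr_ge0 ?invr_ge0 ?(psd_ge0 hX) ?(psd_ge0 hG) //.
  all: rewrite ?mulr_ge0 ?(ltW beta0) ?(ltW theta0) //.
  exact: (psd_ge0 hHf).
Qed.

Lemma opnorm_Mop z :
  opnorm (ip3 ipX ipY ipG) (Mop H B Bs beta theta) z ^+ 2 = mform z z.
Proof. by rewrite sqr_sqrtr // (psd_ge0 mform_psd). Qed.

Lemma mform_norms x y w : mform (x, y, w) (x, y, w) =
  beta^-1 * ipnorm ipX x ^+ 2 + opnorm ipY (yop H B Bs beta) y ^+ 2
  + (beta * theta)^-1 * ipnorm ipG w ^+ 2.
Proof.
rewrite mformE /= /ipnorm /opnorm yopE !sqr_sqrtr ?(psd_ge0 hX) ?(psd_ge0 hG) //.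
  by rewrite [theta * beta]mulrC.
apply: addr_ge0; first exact: (psd_ge0 hHf).
by rewrite mulr_ge0 ?(psd_ge0 hG) // ltW.
Qed.

Hypothesis (pf : proper_fun f) (pg : proper_fun g) (cg : convex_fun g).
Variables (tau1 tau2 : R).
Variables (x : nat -> X) (y : nat -> Y) (gamma : nat -> G).
Variables (v xt : nat -> X) (gammat : nat -> G).
Hypothesis hadmm :
  padmm ipX ipY ipG f g A As B b H beta tau1 tau2 theta x y gamma v xt gammat.

(** The indices are offset: [r k] belongs to iteration k, [dy k] to iteration k + 1. *)
Let r k := A (xt k) + B (y k) - b.
Let dy k := y k.+1 - y k.

Lemma admm_gammat k : gammat k.+1 = gamma k - beta *: (r k.+1 - B (dy k)).
Proof.
have [-> _ _ _ _] := hadmm (ltn0Sn k); congr (_ - _ *: _).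
rewrite /r /dy linearB /= opprB [RHS]addrC [A _ + B (y k.+1)]addrC.
by rewrite -[B (y k.+1) + _ - b]addrA [RHS]addrA subrK addrA [B _ + A _]addrC.
Qed.

Lemma admm_dgamma k : gamma k - gamma k.+1 = (theta * beta) *: r k.+1.
Proof. by have [_ _ _ _ ->] := hadmm (ltn0Sn k); rewrite opprB addrC subrK. Qed.

Lemma admm_dx k : x k - x k.+1 = beta *: v k.+1.
Proof. by have [_ _ _ -> _] := hadmm (ltn0Sn k); rewrite opprB addrC subrK. Qed.

(** Together these say that M (z_k - z_{k+1}) lies in T at the point ([xt k.+1], [y k.+1],
    [gammat k.+1]). *)
Lemma admm_inclusions k :
  [/\ minus_pt (subdiff ipX f (xt k.+1)) (As (gammat k.+1))
        (beta^-1 *: (x k - x k.+1)),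
      minus_pt (subdiff ipY g (y k.+1)) (Bs (gammat k.+1))
        (yop H B Bs beta (y k - y k.+1)) &
      (beta * theta)^-1 *: (gamma k - gamma k.+1) = r k.+1].
Proof.
have [gt [hv _] hy _ _] := hadmm (ltn0Sn k); split.
- by rewrite admm_dx scalerK // gt_eqF.
- rewrite gt; exact: argmin_subdiff hy.
- by rewrite admm_dgamma [beta * _]mulrC scalerK // mulf_neq0 // gt_eqF.
Qed.

(** Monotonicity of T between the inclusion above and 0 in T(zs): the terms in [As] and [Bs] cancel
    against the residual by adjointness. *)
Lemma admm_zero_mono (zs : X * Y * G) k :
  zeros (Top ipX ipY f g A As B Bs b) zs ->
  0 <= mform ((x k, y k, gamma k) - (x k.+1, y k.+1, gamma k.+1))
        ((xt k.+1, y k.+1, gammat k.+1) - zs).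
Proof.
case: zs => [[xs ys] gs] [[/= h1 h2] h3].
have [i1 i2 i3] := admm_inclusions k.
have m1 := subdiff_mono pf i1 h1; have m2 := subdiff_mono pg i2 h2.
have bE : b = A xs + B ys.
  by apply/esym/eqP; rewrite -subr_eq0 -h3.
have Br : r k.+1 = (A (xt k.+1) - A xs) + (B (y k.+1) - B ys).
  by rewrite /r bE opprD addrACA.
have dg : (theta * beta)^-1 *: (gamma k - gamma k.+1) = r k.+1.
  by rewrite [theta * _]mulrC.
rewrite /mform /ip3 /Mop /= dg.
move: m1 m2; rewrite !add0r -![_ + As _ - _]addrA -![_ + Bs _ - _]addrA.
rewrite -!linearB (psdDl hX) (psdDl hY).
rewrite (psdC hX (As _)) (psdC hY (Bs _)) -hA -hB !linearB /= Br.
rewrite !(psdE hG) !(psdE hX) !(psdE hY); lra.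
Qed.

(** * The error condition along the iterates and the summed bound *)

Section SigmaBound.
Variable sigma : R.
Hypothesis (ht1 : 0 <= tau1 < 1) (ht2 : 0 <= tau2 < 1) (th2 : theta < 2).
Hypothesis (s01 : 0 < sigma < 1) (ht2s : tau2 <= sigma).
Hypothesis (hg11 : 0 < g11 tau1 theta sigma) (hc0 : 0 <= gcross tau1 theta sigma).
Hypothesis hdet : ((1 - theta) * gcross tau1 theta sigma) ^+ 2
  <= g11 tau1 theta sigma * g22 tau1 theta sigma.
Hypothesis hsqrt : (gcross tau1 theta sigma - sigma * theta) * Num.sqrt theta
  <= gcross tau1 theta sigma.
Variable zs : X * Y * G.
Hypothesis hzs : zeros (Top ipX ipY f g A As B Bs b) zs.

Let z k := (x k, y k, gamma k).
Let zt k := (xt k, y k, gammat k).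
Let sq (z : X * Y * G) := mform z z.

(** The division by [theta] undoes the scaling of the scalar inequalities; only the initial value
    depends on the zero [zs]. *)
Definition admm_eta k : R :=
  if k is k'.+1 then
    (g22 tau1 theta sigma * (beta * ipG (r k) (r k))
     + gcross tau1 theta sigma * ipY (H (dy k')) (dy k')) / theta
  else mu tau1 theta sigma * sq (z 0%N - zs).

Let E1 k := beta^-1 * ipX (xt k.+1 - x k) (xt k.+1 - x k).
Let E2 k := beta^-1 * ipX (xt k.+1 - x k.+1) (xt k.+1 - x k.+1).
Let h k := ipY (H (dy k)) (dy k).
Let w k := B (dy k).

Lemma admm_sq_prev k : theta * sq (zt k.+1 - z k) =
  theta * E1 k + theta * h k + theta * (beta * ipG (w k) (w k))
  + beta * ipG (r k.+1 - w k) (r k.+1 - w k).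
Proof.
rewrite /sq mformE /= admm_gammat -/(dy k) -/(w k) -/(h k) -/(E1 k).
rewrite [gamma k - _ - _]addrAC subrr add0r (psdNl hG) (psdNr hG) (psdZl hG) (psdZr hG).
by field; rewrite !gt_eqF.
Qed.

Lemma admm_sq_next k : theta * sq (zt k.+1 - z k.+1) =
  theta * E2 k
  + beta * ipG (w k - (1 - theta) *: r k.+1) (w k - (1 - theta) *: r k.+1).
Proof.
rewrite /sq mformE /= -/(E2 k) subrr !linear0.
have -> : gammat k.+1 - gamma k.+1 = beta *: (w k - (1 - theta) *: r k.+1).
  rewrite admm_gammat -/(w k) addrAC admm_dgamma [theta * _]mulrC -scalerA -scalerBr; congr (_ *: _).
  by move: (r k.+1) => rk; rewrite opprB scalerBl scale1r opprB addrCA.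
rewrite (psdZl hG) (psdZr hG).
by field; rewrite !gt_eqF.
Qed.

(** This is the inexactness criterion divided by [beta], since [x k.+1 = x k - beta *: v k.+1]. *)
Lemma admm_inexact k : E2 k <=
  tau1 * (beta * ipG (r k.+1 - w k) (r k.+1 - w k)) + tau2 * E1 k.
Proof.
have [_ [_ +] _ _ _] := hadmm (ltn0Sn k).
have gE : gammat k.+1 - gamma k = - (beta *: (r k.+1 - w k)).
  by rewrite admm_gammat addrAC subrr add0r.
rewrite /= gE /ipnorm !sqr_sqrtr ?(psd_ge0 hX) ?(psd_ge0 hG) // => hle.
rewrite /E2 /E1; have -> : xt k.+1 - x k.+1 = xt k.+1 - x k + beta *: v k.+1.
  by rewrite -admm_dx addrA subrK.
move: hle; rewrite (psdNl hG) (psdNr hG) opprK (psdZl hG) (psdZr hG).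
move: (ipX (_ + _) _) (ipX _ _) (ipG _ _) => e1 e2 rr hle.
rewrite -(ler_pM2l beta0) mulVKf ?gt_eqF //; apply: le_trans hle _.
suff -> : beta * (tau1 * (beta * rr) + tau2 * (beta^-1 * e1))
  = tau1 * (beta * (beta * rr)) + tau2 * e1 by [].
by field; rewrite gt_eqF.
Qed.

(** The [beta] term of [yop] cancels the shift between [gammat k.+1] and
    [gamma k - beta *: r k.+1]. *)
Lemma admm_subgradient k d :
  ipY (yop H B Bs beta (y k - y k.+1) + Bs (gammat k.+1)) d =
  ipG (gamma k - beta *: r k.+1) (B d) - ipY (H (dy k)) d.
Proof.
rewrite (psdDl hY) yopE (psdC hY (Bs _)) -hB (psdC hG (B d)) admm_gammat.
have -> : y k - y k.+1 = - dy k by rewrite opprB.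
move: (r k.+1) (dy k) => rk dk; rewrite !linearN !(psdE hY) !(psdE hG); ring.
Qed.

(** Monotonicity of the subdifferential of [g] between two successive y-subproblems; the update of
    [gamma] turns the coefficient of [r k.+1] into beta (1 - theta). *)
Lemma admm_dy_mono k :
  0 <= beta * (1 - theta) * ipG (r k.+1) (w k.+1) - beta * ipG (r k.+2) (w k.+1)
       - h k.+1 + ipY (H (dy k)) (dy k.+1).
Proof.
have [_ i1 _] := admm_inclusions k; have [_ i2 _] := admm_inclusions k.+1.
have := subdiff_mono pg i2 i1; rewrite -/(dy k.+1) [ipY (_ - _) _](psdDl hY).
rewrite [ipY (- _) _](psdNl hY) !admm_subgradient.
have -> : gamma k.+1 = gamma k - (theta * beta) *: r k.+1.
  by rewrite -admm_dgamma opprB addrC subrK.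
rewrite /h /w; move: (r k.+1) (r k.+2) (dy k) (dy k.+1) => r1 r2 d1 d2.
rewrite !(psdE hG); lra.
Qed.

Lemma admm_hpe k :
  sq (zt k.+1 - z k.+1) + admm_eta k.+1 <= sigma * sq (zt k.+1 - z k) + admm_eta k.
Proof.
have h0 j : 0 <= h j by exact: (psd_ge0 hHf).
have E10 j : 0 <= E1 j by rewrite mulr_ge0 ?(psd_ge0 hX) // invr_ge0 ltW.
have tK a : theta * (a / theta) = a by rewrite mulrCA divff ?mulr1 // gt_eqF.
rewrite -(ler_pM2l theta0) mulrDr [leRHS]mulrDr [theta * (sigma * _)]mulrCA.
rewrite admm_sq_prev admm_sq_next /=.
case: k => [|k]; rewrite /= !tK.
  have D00 := psd_ge0 mform_psd (z 0%N - zs).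
  apply: (admm_first_step hG ht1 ht2 theta0 ht2s beta0 hg11 hc0 (h0 0%N)
    (E10 0%N) (admm_inexact 0) th2 hsqrt (D1 := sq (z 1%N - zs)) D00).
  - rewrite -[X in _ + X](admm_sq_prev 0) -[X in _ <= _ + X](admm_sq_next 0).
    rewrite -!mulrDr ler_pM2l //.
    have := hpe_fejer mform_psd (admm_zero_mono 0 hzs); exact.
  (* The distance hypothesis is |z_0 - z_1|^2 <= 2 D0 + 2 D1 with the nonnegative x-part dropped. *)
  - have := psd_sqD_le mform_psd (z 0%N - zs) (- (z 1%N - zs)).
    rewrite (psdNl mform_psd) (psdNr mform_psd) opprK -/(sq (z 0%N - zs)) -/(sq (z 1%N - zs)).
    have -> : z 0%N - zs - (z 1%N - zs) = z 0%N - z 1%N.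
      by rewrite opprB addrA subrK.
    apply: le_trans; rewrite mformE /=.
    have -> : y 0%N - y 1%N = - dy 0 by rewrite opprB.
    have -> : H (- dy 0) = - H (dy 0) by rewrite linearN.
    have -> : B (- dy 0) = - w 0 by rewrite linearN.
    rewrite admm_dgamma !(psdNl hY, psdNr hY, psdNl hG, psdNr hG) !opprK.
    rewrite (psdZl hG) (psdZr hG).
    have -> : (theta * beta)^-1 * (theta * beta * (theta * beta * ipG (r 1) (r 1)))
      = theta * (beta * ipG (r 1) (r 1)).
      by rewrite mulKf ?mulrA // mulf_neq0 // gt_eqF.
    by rewrite lerD2r lerDr mulr_ge0 ?(psd_ge0 hX) // invr_ge0 ltW.
apply: (admm_step hG theta0 s01 ht2s beta0 hg11 hc0 hdet (h0 k.+1) (E10 k.+1)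
  (admm_inexact k.+1) (s := ipY (H (dy k)) (dy k.+1)) _ (admm_dy_mono k)).
(* Young's inequality with weight 1 bounds the mixed H-term by the mean of [h k] and [h k.+1]. *)
have := psd_young hHf 1 (dy k) (dy k.+1).
rewrite /h /=; lra.
Qed.

Lemma admm_eta_ge0 k : 0 <= admm_eta k.
Proof.
have g0 := g22_ge0 hg11 hdet.
case: k => [|k] /=.
  rewrite mulr_ge0 ?(psd_ge0 mform_psd) // mu_sqrt // mulr_ge0 //.
    by rewrite divr_ge0 ?mulr_ge0 ?sqrtr_ge0 // ltW.
  by rewrite le_max ler01.
rewrite divr_ge0 ?(ltW theta0) // addr_ge0 // !mulr_ge0 ?(psd_ge0 hG) ?(ltW beta0) //.
exact: (psd_ge0 hHf).
Qed.

Lemma admm_sum n :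
  (\sum_(i < n) sq (z i - z i.+1))
  <= (2 * (1 + sigma) + 4 * mu tau1 theta sigma) / (1 - sigma) * sq (z 0%N - zs).
Proof.
have /andP[s0 s1] := s01.
rewrite mulrAC ler_pdivlMr ?subr_gt0 // [leLHS]mulrC.
have h1 : 0 <= sigma < 1 by rewrite ltW.
have := hpe_sum mform_psd h1 (fun k => admm_zero_mono k hzs) admm_eta_ge0 admm_hpe n.
by move=> h2; apply: le_trans h2 _; rewrite /admm_eta [leRHS]mulrDl mulrA.
Qed.

End SigmaBound.

End Admm.

(** * Averaging and the conclusion *)

Lemma exists_le_mean (R : realType) (a : nat -> R) (C : R) n :
  (0 < n)%N -> \sum_(i < n) a i <= C ->
  exists2 i : nat, (i < n)%N & a i <= C / n%:R.
Proof.
move=> n0 hC; apply: contrapT => hn.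
have : C < C; last by rewrite ltxx.
apply: lt_le_trans hC.
have -> : C = \sum_(i < n) C / n%:R.
  by rewrite sumr_const card_ord -[RHS]mulr_natr divfK // pnatr_eq0 -lt0n.
case: n n0 hn => // n _ hn.
apply: ltr_sum => [|i _].
  by apply/hasP; exists ord0; rewrite // mem_index_enum.
by rewrite ltNge; apply/negP => hi; apply: hn; exists i.
Qed.

Theorem theorem3p6 (R : realType) (tau1 tau2 theta : R)
    (htau1 : 0 <= tau1 < 1) (htau2 : 0 <= tau2 < 1)
    (htheta : 0 < theta < theta_max tau1) :
  exists sigma : R,
    [/\ 0 < sigma < 1, tau2 <= sigma, psdmx (Gmx tau1 theta sigma) &
    forall (X Y G : vectType R)
      (ipX : {dot X for idfun}) (ipY : {dot Y for idfun}) (ipG : {dot G for idfun})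
      (f : X -> \bar R) (g : Y -> \bar R)
      (A : 'Hom(X, G)) (As : 'Hom(G, X)) (B : 'Hom(Y, G)) (Bs : 'Hom(G, Y))
      (b : G) (H : 'End(Y)) (beta : R)
      (x : nat -> X) (y : nat -> Y) (gamma : nat -> G)
      (v xt : nat -> X) (gammat : nat -> G),
      let T := Top ipX ipY f g A As B Bs b in
      let M := Mop H B Bs beta theta in
      proper_fun f -> closed_fun ipX f -> convex_fun f ->
      proper_fun g -> closed_fun ipY g -> convex_fun g ->
      is_adjoint ipX ipG A As -> is_adjoint ipY ipG B Bs ->
      selfadjoint_psd ipY H ->
      0 < beta ->
      zeros T !=set0 ->
      padmm ipX ipY ipG f g A As B b H beta tau1 tau2 theta x y gamma v xt gammat ->
      (forall k : nat, (1 <= k)%N ->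
        [/\ minus_pt (subdiff ipX f (xt k)) (As (gammat k))
              (beta^-1 *: (x k.-1 - x k)),
            minus_pt (subdiff ipY g (y k)) (Bs (gammat k))
              (yop H B Bs beta (y k.-1 - y k)) &
            (beta * theta)^-1 *: (gamma k.-1 - gamma k) = A (xt k) + B (y k) - b])
      /\
      (forall k : nat, (1 <= k)%N ->
        exists i : nat, (1 <= i <= k)%N /\
          Num.sqrt (beta^-1 * ipnorm ipX (x i.-1 - x i) ^+ 2
                    + opnorm ipY (yop H B Bs beta) (y i.-1 - y i) ^+ 2
                    + (beta * theta)^-1 * ipnorm ipG (gamma i.-1 - gamma i) ^+ 2)
          <= Num.sqrt (d0 ipX ipY ipG T M (x 0%N, y 0%N, gamma 0%N))
             / Num.sqrt k%:R
             * Num.sqrt ((2 * (1 + sigma) + 4 * mu tau1 theta sigma) / (1 - sigma)))].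
Proof.
have [sigma [s01 ts [hg11 hc] hdet hsqrt]] := exists_sigma htau1 htau2 htheta.
exists sigma; split => //; first exact: Gmx_psd.
move=> X Y G ipX ipY ipG f g A As B Bs b H beta x y gamma v xt gammat T M.
move=> pf _ _ pg _ cg hA hB hH beta0 Tne hadmm.
have theta2 := theta_lt2 htau1 htheta.
have /andP[theta0 _] := htheta; have /andP[s0 s1] := s01.
split=> [[|k] // _|k k1].
  exact: admm_inclusions hadmm k.
pose z i := (x i, y i, gamma i).
pose sq (u : X * Y * G) := mform ipX ipY ipG B Bs H beta theta u u.
pose K := (2 * (1 + sigma) + 4 * mu tau1 theta sigma) / (1 - sigma).
have K0 : 0 < K.
  apply: divr_gt0; last by rewrite subr_gt0.
  have : 0 <= mu tau1 theta sigma.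
    rewrite mu_sqrt // mulr_ge0 ?le_max ?ler01 //.
    by rewrite divr_ge0 ?mulr_ge0 ?sqrtr_ge0 // ltW.
  lra.
have hM := mform_psd ipX hB hH beta0 theta0.
set D := d0 _ _ _ _ _ _.
have hsum : \sum_(i < k) sq (z i - z i.+1) <= K * D.
  (* The bound holds for every zero of T with the same [K], so it passes to the infimum. *)
  rewrite mulrC -ler_pdivrMr //; apply: lb_le_inf.
    by case: Tne => zs hzs; eexists; exists zs.
  move=> _ [zs hzs <-]; rewrite ler_pdivrMr // mulrC.
  rewrite opnorm_Mop // -[zs - _]opprB (psdNl hM) (psdNr hM) opprK.
  have := (admm_sum hA hB hH beta0 theta0 pf pg cg hadmm htau1 htau2 theta2 s01 ts
    hg11 hc hdet hsqrt hzs k); exact.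
have [i ik hi] := @exists_le_mean R (fun i => sq (z i - z i.+1)) _ _ k1 hsum.
exists i.+1; split; first by [].
have D0 : 0 <= D.
  rewrite -(pmulr_rge0 _ K0); apply: le_trans hsum.
  by apply: sumr_ge0 => j _; exact: psd_ge0 hM _.
rewrite -mform_norms // -/K -sqrtrV ?ler0n // -!sqrtrM ?divr_ge0 ?ler0n //.
apply: ler_wsqrtr; move: hi; rewrite [D / _ * K]mulrC mulrA; exact.
Qed.
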